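(* Let $(S,\cdot)$ be a semigroup and $\alpha\in S^*$. The following are equivalent: (1) $\alpha$ is minimal; (2) for every $A\in\mathcal U_\alpha$, the set $A_\alpha$ is syndetic; (3) for every $\beta\in S^*$ there is $\gamma\in S^*$ such that $\alpha\sim\gamma\cdot\beta^*\cdot\alpha^{**}$.
   Context: Nonstandard setup: sufficiently saturated framework of nonstandard analysis with iterated star map; $S^*$, $S^{**}=(S^* )^*$, $S^{***}$, etc.; for $\alpha\in S^*$, $\alpha^*\in S^{**}$ and $\alpha^{**}\in S^{***}$ are its iterated images; for $\beta\in S^*$, $\beta^*\in S^{**}$; the operation of $S$ extends by transfer, so $\gamma\cdot\beta^*\cdot\alpha^{**}\in S^{***}$. For $\delta\in S^{(k)*}$ (the $k$-th iterate), $\mathcal U_\delta=\{B\subseteq S:\delta\in B^{(k)*}\}$, and $\delta\sim\epsilon$ iff $\mathcal U_\delta=\mathcal U_\epsilon$. $\beta S$ is the semigroup of ultrafilters on $S$ with $B\in\mathcal U\cdot\mathcal V\iff\{s:s^{-1}B\in\mathcal V\}\in\mathcal U$ ($s^{-1}B=\{t:st\in B\}$), and $K(\beta S)$ its smallest two-sided ideal; $\delta$ is minimal if $\mathcal U_\delta\in K(\beta S)$. For $A\subseteq S$, $A_\alpha=\{s\in S:s\cdot\alpha\in A^*\}$. $B\subseteq S$ is syndetic if there is a finite $G\subseteq S$ with $S=\{s:gs\in B\text{ for some }g\in G\}$. *)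

(* Defs.v *)
From HB Require Import structures.
From mathcomp Require Import all_boot.
From mathcomp Require Import boolp classical_sets filter cardinality.

Set Implicit Arguments.
Unset Strict Implicit.
Unset Printing Implicit Defensive.

Local Open Scope classical_set_scope.
Local Open Scope group_scope.

(** ** First-order logic over all types

    The sorts are the types, and every function and every subset of a type is
    a symbol.  Since [set X] is itself a sort, quantification over subsets,
    families of subsets, functions, etc. is available.  A formula lives in a
    list [G] of sorts, the sorts of its free variables. *)

Inductive var : seq Type -> Type -> Type :=
| VHere X G : var (X :: G) X
| VNext X Y G : var G X -> var (Y :: G) X.

Inductive term (G : seq Type) : Type -> Type :=
| Var X : var G X -> term G X
| App X Y : (X -> Y) -> term G X -> term G Y
| Pair X Y : term G X -> term G Y -> term G (X * Y).

Inductive formula (G : seq Type) : Type :=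
| FEq X : term G X -> term G X -> formula G
| FMem X : set X -> term G X -> formula G
| FNot : formula G -> formula G
| FAnd : formula G -> formula G -> formula G
| FAll X : formula (X :: G) -> formula G.

(** An interpretation of the sorts and symbols.  [pr] interprets pairing, so
    that a binary function or relation on [X] and [Y] is a unary one on
    [X * Y]. *)
Record interp := Interp {
  car :> Type -> Type;
  fn : forall X Y, (X -> Y) -> car X -> car Y;
  rl : forall X, set X -> set (car X);
  pr : forall X Y, car X -> car Y -> car (X * Y) }.
Arguments fn i {X Y}.
Arguments rl i {X}.
Arguments pr i {X Y}.

Definition standard : interp :=
  @Interp id (fun _ _ f => f) (fun _ A => A) (fun _ _ => pair).

Fixpoint env (F : Type -> Type) (G : seq Type) : Type :=
  if G is X :: G' then (F X * env F G')%type else unit.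

Fixpoint map_env (F F' : Type -> Type) (h : forall X, F X -> F' X)
    (G : seq Type) : env F G -> env F' G :=
  match G with
  | [::] => id
  | X :: G' => fun e => (h X e.1, map_env h e.2)
  end.

Fixpoint lookup (F : Type -> Type) G X (v : var G X) : env F G -> F X :=
  match v in var G X return env F G -> F X with
  | VHere _ _ => fun e => e.1
  | VNext _ _ _ v' => fun e => lookup v' e.2
  end.

Fixpoint eval (M : interp) G X (t : term G X) (e : env M G) : M X :=
  match t in term _ X return M X with
  | Var _ v => lookup v e
  | App _ _ f t' => fn M f (eval t' e)
  | Pair _ _ t1 t2 => pr M (eval t1 e) (eval t2 e)
  end.

Fixpoint holds (M : interp) G (phi : formula G) : env M G -> Prop :=
  match phi with
  | FEq _ t u => fun e => eval t e = eval u e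
  | FMem _ A t => fun e => rl M A (eval t e)
  | FNot phi1 => fun e => ~ holds phi1 e
  | FAnd phi1 phi2 => fun e => holds phi1 e /\ holds phi2 e
  | @FAll _ X phi1 => fun e => forall x : M X, @holds M (X :: G) phi1 (x, e)
  end.

(** ** Nonstandard frameworks

    [hyper X] is the hyper-extension of [X], [fn hyper f] and [rl hyper A] are
    the hyper-extensions of the function [f] and of the set [A], and [star x]
    is the image of [x : X] under the star map.  As [hyper] acts on all types,
    the star map can be iterated. *)
Record nonstandard := Nonstandard {
  hyper : interp;
  star : forall X : Type, X -> hyper X;
  transfer : forall (G : seq Type) (phi : formula G) (e : env standard G),
    @holds hyper G phi (map_env star e) <-> @holds standard G phi e }.
Coercion hyper : nonstandard >-> interp.
Arguments star n {X}.

(** The internal subset of [hyper X] coded by an element of [hyper (set X)]. *)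
Definition internal (N : nonstandard) (X : Type) (F : N (set X)) : set (N X) :=
  [set xi | rl N [set p : X * set X | p.2 p.1] (pr N xi F)].

(** Saturation for families of internal sets indexed by [J], that is,
    kappa-saturation where kappa is the cardinal successor of that of [J]. *)
Definition saturated (N : nonstandard) (J : Type) : Prop :=
  forall (X : Type) (F : J -> N (set X)),
    (forall D : set J, finite_set D ->
       exists xi : N X, forall j, D j -> internal (F j) xi) ->
    exists xi : N X, forall j, internal (F j) xi.

Section Iterated.
Variable N : nonstandard.

Fixpoint hyperk (k : nat) (X : Type) : Type :=
  if k is k'.+1 then N (hyperk k' X) else X.

Fixpoint rlk (k : nat) (X : Type) (A : set X) : set (hyperk k X) :=
  match k return set (hyperk k X) with
  | 0 => A
  | k'.+1 => rl N (@rlk k' X A)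
  end.

Fixpoint opk (k : nat) (X : Type) (op : X -> X -> X) :
    hyperk k X -> hyperk k X -> hyperk k X :=
  match k return hyperk k X -> hyperk k X -> hyperk k X with
  | 0 => op
  | k'.+1 => fun x y => fn N (fun p => @opk k' X op p.1 p.2) (pr N x y)
  end.

Definition stark (k : nat) (X : Type) (x : hyperk k X) : hyperk k.+1 X :=
  star N x.

(** The inclusion of the [k]-th hyper-extension of [X] in the next one: the
    [k]-th hyper-extension of [x |-> star x], which identifies each element of
    [X] with its image under the star map.  For [k > 0] this is not [stark]:
    an element of [hyper X] outside the range of [star] differs from its image
    under the star map. *)
Fixpoint incl (k : nat) (X : Type) : hyperk k X -> hyperk k.+1 X :=
  match k return hyperk k X -> hyperk k.+1 X with
  | 0 => fun x => star N x
  | k'.+1 => fn N (@incl k' X)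
  end.

End Iterated.

Arguments hyperk N k X : clear implicits.
Arguments rlk N k {X} A.
Arguments opk N k {X} op.
Arguments stark {N k X} x.
Arguments incl {N k X} x.

(** ** The semigroup of ultrafilters *)

Lemma ultraP T (F : set_system T) :
  ProperFilter F -> (forall A, F A \/ F (~` A)) -> UltraFilter F.
Proof.
move=> FF FC; split=> // G GG FG; apply/seteqP; split=> // A GA.
case: (FC A) => // /FG GCA; exfalso; apply: (@filter_not_empty _ G GG).
by rewrite -(setICr A); apply: filterI.
Qed.

Record beta (T : Type) :=
  Beta { members :> set_system T; members_ultra : UltraFilter members }.

Lemma beta_inj T (U V : beta T) : U = V :> set_system T -> U = V.
Proof.
by case: U V => [U hU] [V hV] /= UV; case: V / UV hV => hV; congr Beta.
Qed.

HB.instance Definition _ T := gen_eqMixin (beta T).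
HB.instance Definition _ T := gen_choiceMixin (beta T).

Section UltraMul.
Variable S : semigroupType.

Definition ultra_mul (U V : set_system S) : set_system S :=
  [set B | U [set s | V [set t | B (s * t)]]].

Lemma ultra_mul_ultra (U V : set_system S) :
  UltraFilter U -> UltraFilter V -> UltraFilter (ultra_mul U V).
Proof.
move=> UU UV; apply: ultraP => [|A].
  apply: Build_ProperFilter.
    rewrite /ultra_mul /= => h; apply: (@filter_not_empty _ U _).
    by apply: filterS h => s /= h; apply: (@filter_not_empty _ V _).
  apply: Build_Filter => [|A B|A B AB]; rewrite /ultra_mul /=.
  - by apply: (filterS _ filterT) => s _ /=; apply: filterT.
  - move=> hA hB; apply: filterS2 hA hB => s /= hA' hB'.
    exact: filterI hA' hB'.
  - move=> hA; apply: filterS hA => s /= hA.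
    by apply: (filterS _ hA) => t /=; apply: AB.
case: (in_ultra_setVsetC [set s | V [set t | A (s * t)]] UU) => h; first by left.
right; apply: filterS h => s /= nA.
by case: (in_ultra_setVsetC [set t | A (s * t)] UV) => // /nA.
Qed.

Definition beta_mul (U V : beta S) : beta S :=
  Beta (ultra_mul_ultra (members_ultra U) (members_ultra V)).

Lemma beta_mulA : associative beta_mul.
Proof.
move=> U V W; apply: beta_inj; apply: funext => B; rewrite /= /ultra_mul /mkset.
congr (members U _); apply: funext => s; congr (members V _); apply: funext => t.
by congr (members W _); apply: funext => u; rewrite mulgA.
Qed.

HB.instance Definition _ := isSemigroup.Build (beta S) beta_mulA.

End UltraMul.

Definition ideal (T : semigroupType) (I : set T) : Prop :=
  I !=set0 /\ forall x y, I y -> I (x * y) /\ I (y * x).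

(** The smallest two-sided ideal; a semigroup has one exactly when this
    intersection is nonempty. *)
Definition smallest_ideal (T : semigroupType) : set T :=
  \bigcap_(I in @ideal T) I.

Definition syndetic (S : semigroupType) (B : set S) : Prop :=
  exists2 G : set S, finite_set G & forall s, exists2 g, G g & B (g * s).

(** ** Ultrafilters generated by hyper-points *)

Section Ultra.
Variable N : nonstandard.

Definition ufilter (k : nat) (X : Type) (d : hyperk N k X) : set_system X :=
  [set B | rlk N k B d].

Lemma rlT X : rl N [set: X] = [set: N X].
Proof.
have [_ h] := @transfer N [::] (FAll (FMem [set: X] (Var (VHere X [::])))) tt.
by apply/seteqP; split=> // xi _; apply: h => x.
Qed.

Lemma rlI X (A B : set X) : rl N (A `&` B) = rl N A `&` rl N B.
Proof.
pose a := FMem A (Var (VHere X [::])); pose b := FMem B (Var (VHere X [::])).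
pose c := FMem (A `&` B) (Var (VHere X [::])).
pose phi := FAll (FAnd (FNot (FAnd (FAnd a b) (FNot c)))
  (FNot (FAnd c (FNot (FAnd a b))))).
have /(@transfer N [::] phi tt).2 h : @holds standard [::] phi tt.
  by move=> x; split=> -[h1]; apply.
apply/seteqP; split=> xi /= H; have [h1 h2] := h xi; apply: contrapT => H'.
  by apply: h2.
by apply: h1.
Qed.

Lemma rlC X (A : set X) : rl N (~` A) = ~` rl N A.
Proof.
pose a := FMem A (Var (VHere X [::])); pose c := FMem (~` A) (Var (VHere X [::])).
pose phi := FAll (FAnd (FNot (FAnd a c))
  (FNot (FAnd (FNot a) (FNot c)))).
have /(@transfer N [::] phi tt).2 h : @holds standard [::] phi tt.
  by move=> x; split=> -[h1]; apply.
apply/seteqP; split=> xi /= H; have [h1 h2] := h xi.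
  by move=> H'; apply: h1.
by apply: contrapT => H'; apply: h2.
Qed.

Lemma rlkT k X : rlk N k [set: X] = setT.
Proof. by elim: k => //= k ->; rewrite rlT. Qed.

Lemma rlkI k X (A B : set X) : rlk N k (A `&` B) = rlk N k A `&` rlk N k B.
Proof. by elim: k => //= k ->; rewrite rlI. Qed.

Lemma rlkC k X (A : set X) : rlk N k (~` A) = ~` rlk N k A.
Proof. by elim: k => //= k ->; rewrite rlC. Qed.

Lemma ufilter_ultra k X (d : hyperk N k X) : UltraFilter (ufilter d).
Proof.
apply: ultraP => [|A]; last by rewrite /ufilter /= rlkC; apply: EM.
split; first by rewrite /ufilter /= -setCT rlkC rlkT; apply.
split=> [|A B|A B AB]; rewrite /ufilter /=; first by rewrite rlkT.
- by rewrite rlkI.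
- by rewrite -(setIidl AB) rlkI => -[].
Qed.

Definition ultrafilter_of k X (d : hyperk N k X) : beta X :=
  Beta (ufilter_ultra d).

Definition sim k l X (d : hyperk N k X) (e : hyperk N l X) : Prop :=
  ultrafilter_of d = ultrafilter_of e.

Definition minimal k (S : semigroupType) (d : hyperk N k S) : Prop :=
  smallest_ideal (ultrafilter_of d).

Definition shift_set (S : semigroupType) (alpha : hyperk N 1 S) (A : set S) :
    set S :=
  [set s | rlk N 1 A (opk N 1 *%g (incl (k := 0) s) alpha)].

End Ultra.

(* Main.v *)
(* By saturation every ultrafilter on [S] is generated by a point of the
   hyper-extension of [S], and the triple product in (3) generates the product
   of the three ultrafilters; so the statement concerns only [beta S].
   Write [W] for the ultrafilter of [alpha].  The ultrafilters [W] that belong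
   to the closed left ideal generated by [V * W], for every [V], form a
   two-sided ideal, nonempty because it contains every point of a minimal
   closed left ideal; hence it contains the smallest ideal.  For such [W], if
   the sets [g^-1 A_alpha] with [g] in a finite set never covered [S], some
   ultrafilter [V] would avoid all of them, so [A] would belong to no
   [U * V * W].  Conversely syndeticity makes the sets
   [{g | A belongs to g * V * W}], for [A] in [W], a filter base, and an
   ultrafilter [U] extending it satisfies [W = U * V * W].  Finally, such an
   equation with [V] in an ideal puts [W] in this ideal. *)

Require Import Defs.
From mathcomp Require Import all_boot finmap.
From mathcomp Require Import boolp classical_sets filter cardinality.

Set Implicit Arguments.
Unset Strict Implicit.
Unset Printing Implicit Defensive.

Local Open Scope classical_set_scope.
Local Open Scope group_scope.

#[local] Existing Instance members_ultra.

(** * Consequences of transfer and saturation *)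

Section Transfer.
Variable N : nonstandard.

Lemma rl_star X (A : set X) x : rl N A (star N x) <-> A x.
Proof.
exact: (@transfer N [:: X] (FMem A (Var (VHere X [::]))) (x, tt)).
Qed.

Lemma fn_star X Y (f : X -> Y) x : fn N f (star N x) = star N (f x).
Proof.
by apply: (@transfer N [:: X; Y] (FEq (App f (Var (VHere X [:: Y])))
  (Var (VNext X (VHere Y [::])))) (x, (f x, tt))).2.
Qed.

Lemma fn_cst X Y (c : Y) (xi : N X) : fn N (fun=> c) xi = star N c.
Proof.
by apply: (@transfer N [:: Y] (FAll (FEq (App (fun=> c) (Var (VHere X [:: Y])))
  (Var (VNext X (VHere Y [::]))))) (c, tt)).2 xi.
Qed.

Lemma fn_comp X Y Z (f : X -> Y) (g : Y -> Z) xi :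
  fn N g (fn N f xi) = fn N (g \o f) xi.
Proof.
pose x := Var (VHere X [::]).
by apply: (@transfer N [::] (FAll (FEq (App g (App f x)) (App (g \o f) x))) tt).2 xi.
Qed.

Lemma pr_fn X Y Z (f : X -> Y) (g : X -> Z) xi :
  pr N (fn N f xi) (fn N g xi) = fn N (fun x => (f x, g x)) xi.
Proof.
pose x := Var (VHere X [::]).
by apply: (@transfer N [::] (FAll (FEq (Pair (App f x) (App g x))
  (App (fun x => (f x, g x)) x))) tt).2 xi.
Qed.

Lemma fn_id X (xi : N X) : fn N id xi = xi.
Proof.
pose x := Var (VHere X [::]).
by apply: (@transfer N [::] (FAll (FEq (App id x) x)) tt).2 xi.
Qed.

Lemma rl_fn X Y (f : X -> Y) (A : set Y) xi :
  rl N A (fn N f xi) <-> rl N (f @^-1` A) xi.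
Proof.
pose x := Var (VHere X [::]).
pose a := FMem A (App f x); pose b := FMem (f @^-1` A) x.
pose phi := FAll (FAnd (FNot (FAnd a (FNot b))) (FNot (FAnd b (FNot a)))).
have /(@transfer N [::] phi tt).2 h : @holds standard [::] phi tt.
  by move=> u; split=> -[h1]; apply.
by have [h1 h2] := h xi; split=> H; apply: contrapT => H'; [apply: h1|apply: h2].
Qed.

Lemma internal_star X (A : set X) : internal (star N A) = rl N A.
Proof.
apply: funext => xi; apply/propext; rewrite /internal /mkset.
have -> : pr N xi (star N A) = fn N (fun x => (x, A)) xi.
  by rewrite -(pr_fn id) fn_id fn_cst.
exact: rl_fn.
Qed.

(** Products of points depending on one [xi] are computed pointwise; a factor [star N c] takes this
    form by [fn_cst]. *)
Lemma opkS_fn k X Y (op : Y -> Y -> Y) (f g : X -> hyperk N k Y) (xi : N X) :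
  opk N k.+1 op (fn N f xi) (fn N g xi) = fn N (fun x => opk N k op (f x) (g x)) xi.
Proof. by rewrite /= pr_fn fn_comp. Qed.

Lemma rl_shift (S : semigroupType) (alpha : N S) (A : set S) s :
  rlk N 1 A (opk N 1 *%g (star N s) alpha) <->
  rl N [set t | A (s * t)] alpha.
Proof.
by rewrite -(fn_cst s alpha) -{2}(fn_id alpha) (@opkS_fn 0) /= rl_fn.
Qed.

(** [incl] and [stark] put the factors at separate levels: the product is the extension at [gamma]
    of a map in [s], whose values are extensions at [beta] of maps in [t]. Each level thus
    contributes one ultrafilter quantifier. *)
Lemma ultrafilter_of_mul3 (S : semigroupType) (gamma beta alpha : hyperk N 1 S) :
  ultrafilter_of (opk N 3 *%g (opk N 3 *%g (incl (incl gamma))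
                                           (incl (stark beta)))
                              (stark (stark alpha))) =
  (ultrafilter_of gamma * ultrafilter_of beta * ultrafilter_of alpha)%g.
Proof.
have incl_gamma : incl (incl gamma) = fn N (fun s => star N (star N s)) gamma.
  rewrite /= !fn_comp; congr (fn N _ _).
  by apply: funext => s /=; rewrite fn_star.
have incl_beta : incl (stark beta) = fn N (fun=> fn N (star N (X:=S)) beta) gamma.
  by rewrite fn_cst /stark /= fn_star.
have E : opk N 3 *%g (opk N 3 *%g (incl (incl gamma)) (incl (stark beta)))
    (stark (stark alpha)) =
  fn N (fun s => fn N (fun t => opk N 1 *%g (star N (s * t)) alpha) beta) gamma.
  rewrite incl_gamma incl_beta /stark -(fn_cst (star N alpha) gamma) !opkS_fn.
  congr (fn N _ _); apply: funext => s.
  rewrite -(fn_cst (star N s) beta) -(fn_cst alpha beta) !opkS_fn.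
  congr (fn N _ _); apply: funext => t.
  by rewrite -(fn_cst s alpha) -(fn_cst t alpha) (@opkS_fn 0) !fn_cst.
rewrite E -mulgA; apply: beta_inj; apply: funext => A; apply/propext.
apply: iff_trans (rl_fn _ _ _) _.
suff -> : (fun s => fn N (fun t =>
    opk N 1 *%g (star N (s * t)) alpha) beta) @^-1` rl N (rl N A) =
  [set s | rl N [set t | rl N [set u | A (s * (t * u))] alpha] beta] by [].
apply: funext => s; apply/propext; apply: iff_trans (rl_fn _ _ _) _.
suff -> : (fun t => opk N 1 *%g (star N (s * t)) alpha) @^-1` rl N A =
  [set t | rl N [set u | A (s * (t * u))] alpha] by [].
apply: funext => t; apply/propext; apply: iff_trans (rl_shift _ _ _) _.
by under eq_set do rewrite -mulgA.
Qed.

Lemma shift_setE (S : semigroupType) (alpha : hyperk N 1 S) (A : set S) :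
  shift_set alpha A = [set s | ufilter alpha [set t | A (s * t)]].
Proof. by apply: funext => s; apply/propext; apply: rl_shift. Qed.

Lemma ultrafilter_realized (S : Type) (U : beta S) :
  saturated N (set S) -> exists xi : hyperk N 1 S, ultrafilter_of xi = U.
Proof.
move=> Nsat.
(* Saturation is indexed by all of [set S], so the sets outside [U] are replaced by [setT]. *)
pose f A := if `[< members U A >] then A else setT.
have Uf A : members U (f A) by rewrite /f; case: asboolP => // _; apply: filterT.
have [D /finite_fsetP[X ->]|xi hxi] := Nsat S (fun A => star N (f A)).
  have /filter_ex[x fx] : members U (\bigcap_(A in [set` X]) f A).
    by apply: filter_bigI => A _; apply: Uf.
  exists (star N x) => A XA.
  by rewrite internal_star; apply/rl_star; apply: fx.
exists xi; apply: beta_inj; apply: max_filter => A UA.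
by have := hxi A; rewrite internal_star /f asboolT.
Qed.

End Transfer.

(** * Recurrent ultrafilters and syndetic sets *)

Section Recurrent.
Variable S : semigroupType.

Lemma beta_mulE (U V : beta S) A :
  members (U * V) A = members U [set s | members V [set t | A (s * t)]].
Proof. by []. Qed.

(* This says that [W] lies in the closed left ideal generated by [V * W] for
   every [V]. *)
Definition recurrent (W : beta S) : Prop := forall (V : beta S) (A : set S),
  members W A -> exists g, members (V * W) [set v | A (g * v)].

Lemma recurrent_mulr (W X : beta S) : recurrent W -> recurrent (W * X).
Proof.
move=> RW V A /(RW V)[g h]; exists g; rewrite mulgA beta_mulE.
by apply: filterS h => s; apply: filterS => t; rewrite /mkset mulgA.
Qed.

(** As [V * (X * W) = V * X * W], recurrence of [W] applies with [V * X] to a translate of [A] lying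
    in [W]. *)
Lemma recurrent_mull (W X : beta S) : recurrent W -> recurrent (X * W).
Proof.
move=> RW V A; rewrite beta_mulE => /filter_ex[x WxA]; have [g h] := RW (V * X) _ WxA.
exists (x * g); rewrite mulgA.
by apply: filterS h => s; rewrite /mkset mulgA.
Qed.

Lemma recurrent_syndetic (W : beta S) (A : set S) :
  recurrent W -> members W A -> syndetic [set s | members W [set t | A (s * t)]].
Proof.
move=> RW WA; apply: contrapT => nsyn.
(* Failure of syndeticity says that [B G] is nonempty for every finite [G]. *)
pose B G : set S := [set s | forall g, G g -> ~ members W [set t | A (g * s * t)]].
have FB : Filter (filter_from [set G : set S | finite_set G] B).
  apply: filter_from_filter => [|G H fG fH]; first by exists set0; exact: finite_set0.
  exists (G `|` H); first by rewrite /= finite_setU.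
  by move=> s BGH; split=> g ?; apply: BGH; first [by left|by right].
have PB : ProperFilter (filter_from [set G : set S | finite_set G] B).
  apply: filter_from_proper => G fG; apply: contrapT => nB; apply: nsyn.
  exists G => // s; apply: contrapT => ns; apply: nB.
  by exists s => g Gg Wg; apply: ns; exists g.
have [V [UV BV]] := ultraFilterLemma PB.
have [g] := RW (Beta UV) A WA; rewrite /= /ultra_mul /= => Vg.
have /BV VB : filter_from [set G : set S | finite_set G] B (B [set g]).
  by exists [set g] => //; apply: finite_set1.
have [s [Wg]] := filter_ex (filterI Vg VB).
by apply=> //; apply: filterS Wg => t /=; rewrite mulgA.
Qed.

(* The closed left ideals of [beta S] are the sets of ultrafilters containing
   a filter that is invariant in the sense of the last clause; minimal closed
   left ideals thus come from maximal invariant filters. *)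
Definition invariant_filter (F : set_system S) : Prop :=
  [/\ ~ F set0,
      forall A B, F A -> F B -> F (A `&` B),
      forall A B, A `<=` B -> F A -> F B &
      forall s A, F A -> F [set t | A (s * t)]].

Lemma maximal_invariant_filter : exists2 M, invariant_filter M &
  forall F, invariant_filter F -> M `<=` F -> F `<=` M.
Proof.
(* The empty family is invariant, which settles the empty chain. *)
have [C CI Ctot|M [MI Mmax]] := @Zorn_bigcup (set S) invariant_filter.
  split=> [[F /CI[]//]|A B [F CF FA] [G CG GB]|A B AB [F CF FA]|s A [F CF FA]].
  - have [FG|GF] := Ctot F G CF CG.
      by exists G => //; have [_ GI _ _] := CI G CG; apply: GI => //; apply: FG.
    by exists F => //; have [_ FI _ _] := CI F CF; apply: FI => //; apply: GF.
  - by exists F => //; have [_ _ FS _] := CI F CF; apply: FS FA.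
  - by exists F => //; have [_ _ _ Fs] := CI F CF; apply: Fs.
exists M => // F FI MF; apply: contrapT => FM; exact: Mmax F (conj MF FM) FI.
Qed.

Lemma exists_recurrent (s0 : S) : exists W, recurrent W.
Proof.
have [M [M0 MI MS Ms] Mmax] := maximal_invariant_filter.
(* Maximality excludes the empty family: adjoining [setT], nonempty because of [s0], keeps [M]
   invariant. *)
have MT : M setT.
  suff /Mmax : invariant_filter (M `|` [set setT]).
    by apply=> [A MA|]; [left|right].
  split=> [[//|/seteqP[_ /(_ s0)]]|A B|A B AB|s A]; first exact.
  - move=> [MA|->] [MB|->]; rewrite ?setIT ?setTI; [left|left|left|right] => //.
    exact: MI.
  - move=> [MA|AT]; [left; exact: MS MA|right].
    by apply/seteqP; split=> // x _; apply: AB; rewrite AT.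
  - by move=> [MA|->]; [left; exact: Ms|right].
have MF : ProperFilter M by split=> //; split.
have [U [UU MU]] := ultraFilterLemma MF; pose W := Beta UU; exists W => V A WA.
apply: contrapT => nA.
(* This is the filter of the closed left ideal generated by [V * W]. It contains [M], hence lies in
   [M] by maximality; by [nA] it contains the complement of [A], which then belongs to [W]. *)
suff /Mmax H : invariant_filter [set B | forall g, members (V * W) [set v | B (g * v)]].
  have /MU WnA : M (~` A).
    apply: H => [B MB g|g].
      rewrite beta_mulE; apply: filterE => s; apply: MU; rewrite /mkset.
      by apply: MS (Ms (g * s) _ MB) => t /=; rewrite mulgA.
    case: (in_ultra_setVsetC [set v | A (g * v)] (members_ultra (V * W))) => //.
    by move=> h; case: nA; exists g.
  by have [x []] := filter_ex (filterI (F := members W) WA WnA).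
split=> [/(_ s0)|A' B' hA hB g|A' B' AB hA g|s A' hA g].
- exact: filter_not_empty.
- exact: filterI (hA g) (hB g).
- by apply: filterS (hA g) => v; apply: AB.
- by apply: filterS (hA (s * g)) => v /=; rewrite mulgA.
Qed.

Lemma smallest_ideal_recurrent (W : beta S) : smallest_ideal W -> recurrent W.
Proof.
apply; split; last by move=> X Y RY; split; [apply: recurrent_mull|apply: recurrent_mulr].
by have [s0 _] := filter_ex (@filterT _ (members W) _); apply: exists_recurrent s0.
Qed.

Lemma syndetic_left_mul (W : beta S) :
  (forall A, members W A -> syndetic [set s | members W [set t | A (s * t)]]) ->
  forall V, exists U, W = U * V * W.
Proof.
move=> Wsyn V.
pose C A : set S := [set g | members (V * W) [set v | A (g * v)]].
have FC : Filter (filter_from (members W) C).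
  apply: filter_from_filter => [|A B WA WB]; first by exists setT; apply: filterT.
  exists (A `&` B); first exact: filterI.
  by move=> g CAB; split; apply: filterS CAB => v [].
have PC : ProperFilter (filter_from (members W) C).
  apply: filter_from_proper => A WA; have [G fG Gsyn] := Wsyn A WA.
  apply: contrapT => nC.
  (* If [C A] is empty, [V] contains each of these sets, and [G] is finite; a common point [s]
     contradicts [Gsyn]. *)
  have /filter_ex[s Vs] : members V (\bigcap_(g in G) [set s | ~ members W [set t | A (g * (s * t))]]).
    have /finite_fsetP[X ->] := fG; apply: filter_bigI => g _.
    case: (in_ultra_setVsetC [set s | members W [set t | A (g * (s * t))]] (members_ultra V)) => //.
    by move=> h; case: nC; exists g.
  have [g Gg Wg] := Gsyn s; apply: (Vs g Gg).
  by apply: filterS Wg => t /=; rewrite mulgA.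
have [U [UU CU]] := ultraFilterLemma PC; exists (Beta UU).
(* Between ultrafilters one inclusion suffices, and [A] belongs to [U * (V * W)] exactly when [C A]
   belongs to [U]. *)
apply: beta_inj; apply/esym/max_filter => A WA; rewrite -mulgA.
by apply: CU; exists A.
Qed.

End Recurrent.

Theorem theorem3p1p12 (N : nonstandard) (S : semigroupType)
    (Nsat : saturated N (set S)) (alpha : hyperk N 1 S) :
  [<-> minimal alpha;
       forall A : set S,
         ufilter alpha A -> syndetic (shift_set alpha A);
       forall beta : hyperk N 1 S, exists gamma : hyperk N 1 S,
         sim alpha (opk N 3 *%g (opk N 3 *%g (incl (incl gamma))
                                             (incl (stark beta)))
                               (stark (stark alpha)))].
Proof.
tfae=> [|syn beta|hgamma I [[V IV] Iid]].
- move=> /smallest_ideal_recurrent R A UA.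
  by rewrite shift_setE; exact: (recurrent_syndetic R UA).
- have [|U WU] := @syndetic_left_mul S (ultrafilter_of alpha) _ (ultrafilter_of beta).
    by move=> A /syn; rewrite shift_setE.
  have [gamma gammaU] := ultrafilter_realized U Nsat.
  by exists gamma; rewrite /sim ultrafilter_of_mul3 gammaU.
- have [beta betaV] := ultrafilter_realized V Nsat.
  have [gamma ->] := hgamma beta; rewrite ultrafilter_of_mul3 betaV.
  exact: (Iid _ _ (Iid _ _ IV).1).2.
Qed.
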